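(* For all integers $p,q\ge 0$ and all $z,w\in\mathbb{C}$, $$H_{p,q}\left(z+w,\overline{z}+\overline{w}\right)=p!\,q!\left(\frac12\right)^{(p+q)/2}\sum_{j=0}^{p}\sum_{k=0}^{q}\frac{H_{j,k}(\sqrt{2}z,\sqrt{2}\,\overline{z})}{k!\,j!}\,\frac{H_{p-j,q-k}(\sqrt{2}w,\sqrt{2}\,\overline{w})}{(q-k)!\,(p-j)!}.$$
   Context: For $z=x+iy\in\mathbb{C}$, $\partial_z=\frac12\left(\frac{\partial}{\partial x}-i\frac{\partial}{\partial y}\right)$ and $\partial_{\overline{z}}=\frac12\left(\frac{\partial}{\partial x}+i\frac{\partial}{\partial y}\right)$. The complex Hermite polynomials are, for integers $p,q\ge 0$, $$H_{p,q}(z,\overline{z})=(-1)^{p+q}e^{z\overline{z}}\,\partial_{\overline{z}}^{p}\partial_z^{q}\left(e^{-z\overline{z}}\right).$$ The notation $H_{p,q}(\xi,\overline{\xi})$ means the value of $H_{p,q}$ at the point $\xi\in\mathbb{C}$. *)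

(* Defs.v *)
From Stdlib Require Import Reals.
From Coquelicot Require Import Coquelicot.

Open Scope R_scope.

Definition Cexp (z : C) : C :=
  (exp (Re z) * cos (Im z), exp (Re z) * sin (Im z)).

(* Partial derivatives of f : C -> C with respect to the real coordinates of
   z = x + iy, taken on the real and imaginary parts of f.  [Derive] is total:
   it is the derivative only where the latter exists, which is the case for
   every iterate applied to the smooth function below. *)
Definition partial_x (f : C -> C) (z : C) : C :=
  (Derive (fun x => Re (f (x, Im z))) (Re z),
   Derive (fun x => Im (f (x, Im z))) (Re z)).

Definition partial_y (f : C -> C) (z : C) : C :=
  (Derive (fun y => Re (f (Re z, y))) (Im z),
   Derive (fun y => Im (f (Re z, y))) (Im z)).

Definition partial_z (f : C -> C) (z : C) : C :=
  (/ 2 * (partial_x f z - Ci * partial_y f z))%C.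

Definition partial_zbar (f : C -> C) (z : C) : C :=
  (/ 2 * (partial_x f z + Ci * partial_y f z))%C.

(* [hermiteC p q z] is H_{p,q}(z, conj z). *)
Definition hermiteC (p q : nat) (z : C) : C :=
  ((- 1) ^ (p + q) * Cexp (z * Cconj z)
   * Nat.iter p partial_zbar
       (Nat.iter q partial_z (fun u : C => Cexp (- (u * Cconj u)))) z)%C.

(* Main.v *)
(** Up to the factor [p! q!], the polynomials H_{p,q} are the coefficients of
    the generating function exp (u z + v zbar - u v).  With a parameter [t] in
    front of [u v], such exponentials multiply by adding [z], [zbar] and [t],
    and rescaling [u], [v] by [r] replaces [(t, z, zbar)] by
    [(r^2 t, r z, r zbar)].  The addition formula is the case
    [1 = 1/2 + 1/2] with [r = 1 / sqrt 2].  At the level of coefficients the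
    multiplication law follows from the derivation property of the Euler
    operator on Cauchy products, one variable at a time. *)

Require Import Defs.
From Stdlib Require Import Factorial Reals Lra Lia FunctionalExtensionality.
From Coquelicot Require Import Coquelicot.

Open Scope C_scope.

(** * Cauchy products *)

(** With both indices as arguments, summands can be compared for independent [j] and [m], away from
    truncated subtraction. *)
Definition diag_sum (u : nat -> nat -> C) (n : nat) : C :=
  sum_n (fun j => u j (n - j)%nat) n.

Lemma sum_n_ext_C (f g : nat -> C) n :
  (forall j, (j <= n)%nat -> f j = g j) -> sum_n f n = sum_n g n :> C.
Proof. exact (sum_n_ext_loc (G := C_AbelianMonoid) f g n). Qed.

Lemma diag_sum_ext (u v : nat -> nat -> C) n :
  (forall j m, u j m = v j m) -> diag_sum u n = diag_sum v n.
Proof. intros H; apply sum_n_ext_C; intros j _; apply H. Qed.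

Lemma diag_sum_plus (u v : nat -> nat -> C) n :
  diag_sum (fun j m => u j m + v j m) n = diag_sum u n + diag_sum v n.
Proof. exact (sum_n_plus (G := C_AbelianMonoid) _ _ n). Qed.

Lemma diag_sum_scal (c : C) (u : nat -> nat -> C) n :
  diag_sum (fun j m => c * u j m) n = c * diag_sum u n.
Proof. exact (sum_n_mult_l (K := C_Ring) c _ n). Qed.

Lemma diag_sum_O (u : nat -> nat -> C) : diag_sum u 0 = u O O.
Proof. exact (sum_O (G := C_AbelianMonoid) _). Qed.

Lemma diag_sum_S_l (u : nat -> nat -> C) n :
  diag_sum u (S n) = u O (S n) + diag_sum (fun j m => u (S j) m) n.
Proof.
  unfold diag_sum, sum_n.
  rewrite (sum_Sn_m (G := C_AbelianMonoid)) by lia.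
  rewrite <- (sum_n_m_S (G := C_AbelianMonoid)).
  reflexivity.
Qed.

Lemma diag_sum_S_r (u : nat -> nat -> C) n :
  diag_sum u (S n) = diag_sum (fun j m => u j (S m)) n + u (S n) O.
Proof.
  unfold diag_sum.
  rewrite (sum_Sn (G := C_AbelianMonoid)), Nat.sub_diag.
  apply (f_equal2 Cplus); [|reflexivity].
  apply sum_n_ext_C; intros j Hj.
  now replace (S n - j)%nat with (S (n - j)) by lia.
Qed.

Definition nC (n : nat) : C := RtoC (INR n).

Lemma nC_S n : nC (S n) = nC n + 1.
Proof. unfold nC; rewrite S_INR; apply RtoC_plus. Qed.

Lemma nC_S_neq0 n : nC (S n) <> 0.
Proof. intros H; apply (not_0_INR (S n)); [lia | now apply RtoC_inj]. Qed.

Lemma nC_fact_neq0 n : nC (fact n) <> 0.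
Proof. intros H; apply (INR_fact_neq_0 n); now apply RtoC_inj. Qed.

Lemma nC_fact_S n : nC (fact (S n)) = nC (S n) * nC (fact n).
Proof.
  unfold nC; rewrite <- RtoC_mult, <- mult_INR; reflexivity.
Qed.

(** Leibniz rule for the Euler operator: on the antidiagonal [j + m = n + 1], the weight [n + 1]
    splits as [j + m]. *)
Lemma diag_sum_euler (u : nat -> nat -> C) n :
  nC (S n) * diag_sum u (S n)
  = diag_sum (fun j m => nC (S j) * u (S j) m + nC (S m) * u j (S m)) n.
Proof.
  rewrite diag_sum_plus, <- diag_sum_scal.
  transitivity (diag_sum (fun j m => nC j * u j m + nC m * u j m) (S n)).
  - apply sum_n_ext_C; intros j Hj.
    replace (nC (S n)) with (nC j + nC (S n - j)); [ring|].
    unfold nC; rewrite <- RtoC_plus, <- plus_INR.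
    now replace (j + (S n - j))%nat with (S n) by lia.
  (* The boundary terms [j = 0] and [m = 0] carry weight zero, so both reindexings are exact. *)
  - rewrite diag_sum_plus, diag_sum_S_l.
    rewrite (diag_sum_S_r (fun j m => nC m * u j m)).
    change (nC 0) with (RtoC 0); ring.
Qed.

Definition conv (f g : nat -> C) (n : nat) : C :=
  diag_sum (fun j m => f j * g m) n.

(** Multiplication of a power series by its variable. *)
Definition shift (f : nat -> C) (n : nat) : C :=
  match n with O => 0 | S m => f m end.

Lemma conv_shift_l f g n : conv (shift f) g n = shift (conv f g) n.
Proof.
  unfold conv; destruct n as [|n]; simpl.
  - rewrite diag_sum_O; simpl; ring.
  - rewrite diag_sum_S_l; simpl; ring.
Qed.

Lemma conv_shift_r f g n : conv f (shift g) n = shift (conv f g) n.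
Proof.
  unfold conv; destruct n as [|n]; simpl.
  - rewrite diag_sum_O; simpl; ring.
  - rewrite diag_sum_S_r; simpl; ring.
Qed.

(** * Coefficients of exp (u a + v b - t u v) *)

(** Coefficient of [u^p v^q] in F = exp (u a + v b - t u v). The row [p = 0] is exp (v b); the
    recursion is the equation dF/du = (a - t v) F, where multiplication by [v] is [shift] in [q]. *)
Fixpoint hcoef (t a b : C) (p q : nat) : C :=
  match p with
  | O => b ^ q / nC (fact q)
  | S p' => (a * hcoef t a b p' q - t * shift (hcoef t a b p') q) / nC (S p')
  end.

Lemma hcoef_0_S t a b q :
  nC (S q) * hcoef t a b 0 (S q) = b * hcoef t a b 0 q.
Proof.
  cbn [hcoef]; rewrite nC_fact_S; simpl Cpow.
  field; split; [apply nC_fact_neq0 | apply nC_S_neq0].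
Qed.

Lemma hcoef_S t a b p q :
  nC (S p) * hcoef t a b (S p) q
  = a * hcoef t a b p q - t * shift (hcoef t a b p) q.
Proof. cbn [hcoef]; field; apply nC_S_neq0. Qed.

Lemma Cmult_cancel_l (c x y : C) : c <> 0 -> c * x = c * y -> x = y.
Proof.
  intros Hc H.
  replace x with (/ c * (c * x)) by (field; exact Hc).
  rewrite H; field; exact Hc.
Qed.

(** Exponentials multiply by adding their parameters. After multiplication by the index, the Euler
    rule shows that both sides obey the same first-order recurrence, first in [q] on the row
    [p = 0], then in [p]. *)
Lemma hcoef_add t t' a a' b b' p q :
  hcoef (t + t') (a + a') (b + b') p q
  = diag_sum (fun j m => conv (hcoef t a b j) (hcoef t' a' b' m) q) p.
Proof.
  revert q; induction p as [|p IHp]; intros q.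
  - rewrite diag_sum_O; induction q as [|q IHq].
    + unfold conv; rewrite diag_sum_O; simpl.
      change (nC 1) with (RtoC 1); field.
    + apply (Cmult_cancel_l (nC (S q))); [apply nC_S_neq0|].
      rewrite hcoef_0_S, IHq; unfold conv.
      rewrite diag_sum_euler, <- diag_sum_scal.
      apply diag_sum_ext; intros j m.
      transitivity ((nC (S j) * hcoef t a b 0 (S j)) * hcoef t' a' b' 0 m
                    + hcoef t a b 0 j * (nC (S m) * hcoef t' a' b' 0 (S m)));
        [rewrite !hcoef_0_S|]; ring.
  - apply (Cmult_cancel_l (nC (S p))); [apply nC_S_neq0|].
    rewrite hcoef_S, diag_sum_euler.
    set (f := hcoef t a b); set (g := hcoef t' a' b').
    (* [Hl] and [Hr] carry the recurrence in [p] of one factor through the product in [v]; the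
       multiplication by [v] can be pulled out of either factor. *)
    assert (Hl : forall j m, nC (S j) * conv (f (S j)) (g m) q
       = a * conv (f j) (g m) q - t * shift (conv (f j) (g m)) q).
    { intros j m; rewrite <- conv_shift_l; unfold conv.
      rewrite <- !diag_sum_scal.
      replace (diag_sum (fun i k => nC (S j) * (f (S j) i * g m k)) q)
        with (diag_sum (fun i k => a * (f j i * g m k)
                                   + (- t) * (shift (f j) i * g m k)) q).
      - rewrite diag_sum_plus, !diag_sum_scal; ring.
      - apply diag_sum_ext; intros i k; unfold f.
        transitivity ((nC (S j) * hcoef t a b (S j) i) * g m k);
          [rewrite hcoef_S|]; ring. }
    assert (Hr : forall j m, nC (S m) * conv (f j) (g (S m)) q
       = a' * conv (f j) (g m) q - t' * shift (conv (f j) (g m)) q).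
    { intros j m; rewrite <- conv_shift_r; unfold conv.
      rewrite <- !diag_sum_scal.
      replace (diag_sum (fun i k => nC (S m) * (f j i * g (S m) k)) q)
        with (diag_sum (fun i k => a' * (f j i * g m k)
                                   + (- t') * (f j i * shift (g m) k)) q).
      - rewrite diag_sum_plus, !diag_sum_scal; ring.
      - apply diag_sum_ext; intros i k; unfold g.
        transitivity (f j i * (nC (S m) * hcoef t' a' b' (S m) k));
          [rewrite hcoef_S|]; ring. }
    assert (Hs : shift (hcoef (t + t') (a + a') (b + b') p) q
       = diag_sum (fun j m => shift (conv (f j) (g m)) q) p).
    { destruct q as [|q]; simpl; [|apply IHp].
      transitivity (0 * diag_sum (fun _ _ => 0) p); [ring|].
      rewrite <- diag_sum_scal; apply diag_sum_ext; intros; ring. }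
    rewrite Hs, IHp; fold f g.
    transitivity (diag_sum (fun j m => (a + a') * conv (f j) (g m) q
        + (- (t + t')) * shift (conv (f j) (g m)) q) p).
    + rewrite diag_sum_plus, !diag_sum_scal; ring.
    + apply diag_sum_ext; intros j m; rewrite Hl, Hr; ring.
Qed.

Lemma hcoef_scale r t a b p q :
  hcoef (r * r * t) (r * a) (r * b) p q = r ^ (p + q) * hcoef t a b p q.
Proof.
  revert q; induction p as [|p IHp]; intros q.
  - simpl; rewrite Cpow_mult_l; field; apply nC_fact_neq0.
  - apply (Cmult_cancel_l (nC (S p))); [apply nC_S_neq0|].
    rewrite hcoef_S, IHp.
    transitivity (r ^ (S p + q) * (nC (S p) * hcoef t a b (S p) q)); [|ring].
    rewrite hcoef_S; destruct q as [|q]; simpl shift.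
    + simpl; ring.
    (* The shifted coefficient has total degree lower by two; the factor [r * r] in front of [t]
       makes up for it. *)
    + rewrite IHp, Nat.add_succ_r; simpl; rewrite Nat.add_succ_r; simpl; ring.
Qed.

(** * Wirtinger derivatives *)

(** Componentwise, to match [partial_x] and [partial_y]; as a relation it also records that the
    derivatives exist. *)
Definition is_derive_C (f : R -> C) (x : R) (d : C) : Prop :=
  is_derive (fun s => Re (f s)) x (Re d) /\ is_derive (fun s => Im (f s)) x (Im d).

(* [a] and [b] are the derivatives along [z] and [zbar]. *)
Definition is_wirtinger (f : C -> C) (z a b : C) : Prop :=
  is_derive_C (fun x => f (x, Im z)) (Re z) (a + b)
  /\ is_derive_C (fun y => f (Re z, y)) (Im z) (Ci * (a - b)).

Lemma Ci_Ci : Ci * Ci = - (1).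
Proof. apply injective_projections; simpl; ring. Qed.

Lemma partial_x_unique f z d :
  is_derive_C (fun x => f (x, Im z)) (Re z) d -> partial_x f z = d.
Proof.
  intros [H1 H2]; apply injective_projections;
    [exact (is_derive_unique _ _ _ H1) | exact (is_derive_unique _ _ _ H2)].
Qed.

Lemma partial_y_unique f z d :
  is_derive_C (fun y => f (Re z, y)) (Im z) d -> partial_y f z = d.
Proof.
  intros [H1 H2]; apply injective_projections;
    [exact (is_derive_unique _ _ _ H1) | exact (is_derive_unique _ _ _ H2)].
Qed.

(** Since [Ci * Ci = - (1)], the combination is half of [(a + b) + (a - b)]. *)
Lemma partial_z_unique f z a b : is_wirtinger f z a b -> partial_z f z = a.
Proof.
  intros [Hx Hy]; unfold partial_z.
  rewrite (partial_x_unique _ _ _ Hx), (partial_y_unique _ _ _ Hy).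
  replace (/ 2 * (a + b - Ci * (Ci * (a - b))))
    with (/ 2 * (a + b - (Ci * Ci) * (a - b))) by ring.
  rewrite Ci_Ci.
  field; intros H; apply RtoC_inj in H; lra.
Qed.

Lemma partial_zbar_unique f z a b : is_wirtinger f z a b -> partial_zbar f z = b.
Proof.
  intros [Hx Hy]; unfold partial_zbar.
  rewrite (partial_x_unique _ _ _ Hx), (partial_y_unique _ _ _ Hy).
  replace (/ 2 * (a + b + Ci * (Ci * (a - b))))
    with (/ 2 * (a + b + (Ci * Ci) * (a - b))) by ring.
  rewrite Ci_Ci.
  field; intros H; apply RtoC_inj in H; lra.
Qed.

Lemma is_derive_C_plus f g x df dg :
  is_derive_C f x df -> is_derive_C g x dg ->
  is_derive_C (fun s => f s + g s) x (df + dg).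
Proof.
  intros [Hf1 Hf2] [Hg1 Hg2]; split.
  - exact (is_derive_plus _ _ _ _ _ Hf1 Hg1).
  - exact (is_derive_plus _ _ _ _ _ Hf2 Hg2).
Qed.

Lemma is_derive_C_mult f g x df dg :
  is_derive_C f x df -> is_derive_C g x dg ->
  is_derive_C (fun s => f s * g s) x (df * g x + f x * dg).
Proof.
  intros [Hf1 Hf2] [Hg1 Hg2]; split.
  - replace (Re (df * g x + f x * dg)) with
      ((Re df * Re (g x) + Re (f x) * Re dg)
       - (Im df * Im (g x) + Im (f x) * Im dg))%R by (simpl; unfold Re, Im; ring).
    exact (is_derive_minus _ _ _ _ _
      (is_derive_mult _ _ _ _ _ Hf1 Hg1 Rmult_comm)
      (is_derive_mult _ _ _ _ _ Hf2 Hg2 Rmult_comm)).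
  - replace (Im (df * g x + f x * dg)) with
      ((Re df * Im (g x) + Re (f x) * Im dg)
       + (Im df * Re (g x) + Im (f x) * Re dg))%R by (simpl; unfold Re, Im; ring).
    exact (is_derive_plus _ _ _ _ _
      (is_derive_mult _ _ _ _ _ Hf1 Hg2 Rmult_comm)
      (is_derive_mult _ _ _ _ _ Hf2 Hg1 Rmult_comm)).
Qed.

Lemma is_wirtinger_const c z : is_wirtinger (fun _ => c) z 0 0.
Proof.
  split; split; auto_derive; trivial; simpl; ring.
Qed.

Lemma is_wirtinger_id z : is_wirtinger (fun u => u) z 1 0.
Proof.
  split; split; simpl; auto_derive; trivial; simpl; ring.
Qed.

Lemma is_wirtinger_conj z : is_wirtinger Cconj z 0 1.
Proof.
  split; split; simpl; auto_derive; trivial; simpl; ring.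
Qed.

Lemma is_wirtinger_plus f g z a b a' b' :
  is_wirtinger f z a b -> is_wirtinger g z a' b' ->
  is_wirtinger (fun u => f u + g u) z (a + a') (b + b').
Proof.
  intros [Hf1 Hf2] [Hg1 Hg2]; split.
  - replace (a + a' + (b + b')) with ((a + b) + (a' + b')) by ring.
    now apply is_derive_C_plus.
  - replace (Ci * (a + a' - (b + b'))) with (Ci * (a - b) + Ci * (a' - b')) by ring.
    now apply is_derive_C_plus.
Qed.

Lemma is_wirtinger_mult f g z a b a' b' :
  is_wirtinger f z a b -> is_wirtinger g z a' b' ->
  is_wirtinger (fun u => f u * g u) z (a * g z + f z * a') (b * g z + f z * b').
Proof.
  intros [Hf1 Hf2] [Hg1 Hg2]; split.
  (* The product rule on a coordinate line evaluates at [(Re z, Im z)], which equals [z] only by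
     surjective pairing. *)
  - replace (a * g z + f z * a' + (b * g z + f z * b'))
      with ((a + b) * g (Re z, Im z) + f (Re z, Im z) * (a' + b'))
      by (rewrite <- !surjective_pairing; ring).
    exact (is_derive_C_mult _ _ _ _ _ Hf1 Hg1).
  - replace (Ci * (a * g z + f z * a' - (b * g z + f z * b')))
      with (Ci * (a - b) * g (Re z, Im z) + f (Re z, Im z) * (Ci * (a' - b')))
      by (rewrite <- !surjective_pairing; ring).
    exact (is_derive_C_mult _ _ _ _ _ Hf2 Hg2).
Qed.

Lemma is_wirtinger_scal c f z a b :
  is_wirtinger f z a b -> is_wirtinger (fun u => c * f u) z (c * a) (c * b).
Proof.
  intros Hf.
  replace (c * a) with (0 * f z + c * a) by ring.
  replace (c * b) with (0 * f z + c * b) by ring.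
  exact (is_wirtinger_mult _ _ _ _ _ _ _ (is_wirtinger_const c z) Hf).
Qed.

(** * Derivatives of the Gaussian and of the coefficients *)

Definition gauss (u : C) : C := Cexp (- (u * Cconj u)).

(** The exponent is real, so differentiating the Gaussian reduces to real calculus with zero
    imaginary part. *)
Lemma gauss_real x y : gauss (x, y) = RtoC (exp (- (x * x + y * y))).
Proof.
  unfold gauss, Cexp.
  replace (- ((x, y) * Cconj (x, y))) with (RtoC (- (x * x + y * y)))
    by (apply injective_projections; simpl; ring).
  simpl; rewrite cos_0, sin_0, Rmult_1_r, Rmult_0_r; reflexivity.
Qed.

Lemma is_wirtinger_gauss z :
  is_wirtinger gauss z (- Cconj z * gauss z) (- z * gauss z).
Proof.
  destruct z as [x0 y0]; rewrite gauss_real.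
  split; split.
  - apply (is_derive_ext (fun x => exp (- (x * x + y0 * y0)))).
    { intros s; now rewrite gauss_real. }
    auto_derive; trivial; simpl; ring.
  - apply (is_derive_ext (fun _ => 0%R)).
    { intros s; now rewrite gauss_real. }
    auto_derive; trivial; simpl; ring.
  - apply (is_derive_ext (fun y => exp (- (x0 * x0 + y * y)))).
    { intros s; now rewrite gauss_real. }
    auto_derive; trivial; simpl; ring.
  - apply (is_derive_ext (fun _ => 0%R)).
    { intros s; now rewrite gauss_real. }
    auto_derive; trivial; simpl; ring.
Qed.

Lemma Cexp_gauss z : Cexp (z * Cconj z) * gauss z = 1.
Proof.
  destruct z as [x y]; rewrite gauss_real; unfold Cexp.
  replace ((x, y) * Cconj (x, y)) with (RtoC (x * x + y * y))
    by (apply injective_projections; simpl; ring).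
  simpl; rewrite cos_0, sin_0, Rmult_1_r, Rmult_0_r.
  change (RtoC (exp (x * x + y * y)) * RtoC (exp (- (x * x + y * y))) = 1).
  rewrite <- RtoC_mult, <- exp_plus, Rplus_opp_r, exp_0; reflexivity.
Qed.

Lemma is_wirtinger_conj_pow q z :
  is_wirtinger (fun u => Cconj u ^ q) z 0 (nC q * Cconj z ^ pred q).
Proof.
  induction q as [|q IHq].
  - replace (nC 0 * Cconj z ^ pred 0) with (RtoC 0)
      by (change (nC 0) with (RtoC 0); ring).
    exact (is_wirtinger_const 1 z).
  - replace (RtoC 0) with (0 * Cconj z ^ q + Cconj z * 0) by ring.
    replace (nC (S q) * Cconj z ^ pred (S q))
      with (1 * Cconj z ^ q + Cconj z * (nC q * Cconj z ^ pred q)).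
    + exact (is_wirtinger_mult _ _ _ _ _ _ _ (is_wirtinger_conj z) IHq).
    (* At [q = 0] the truncated [pred] is harmless because its factor [nC 0] vanishes. *)
    + rewrite nC_S; destruct q; simpl;
        [change (nC 0) with (RtoC 0)|]; ring.
Qed.

(** Differentiating exp (u z + v zbar - t u v) along zbar multiplies it by [v], hence the [shift] in
    [q]. The derivative along [z] only has to exist, so it is left existential. *)
Lemma is_wirtinger_hcoef t p q z :
  exists a, is_wirtinger (fun u => hcoef t u (Cconj u) p q) z a
              (shift (hcoef t z (Cconj z) p) q).
Proof.
  revert q; induction p as [|p IHp]; intros q.
  - exists 0.
    assert (H := is_wirtinger_scal (/ nC (fact q)) _ _ _ _
                   (is_wirtinger_conj_pow q z)).
    replace (/ nC (fact q) * 0) with (RtoC 0) in H by ring.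
    replace (shift (hcoef t z (Cconj z) 0) q)
      with (/ nC (fact q) * (nC q * Cconj z ^ pred q)).
    + replace (fun u => hcoef t u (Cconj u) 0 q)
        with (fun u => / nC (fact q) * Cconj u ^ q); [exact H|].
      apply functional_extensionality; intros u; simpl; unfold Cdiv; ring.
    + destruct q as [|q]; [change (nC 0) with (RtoC 0); simpl; ring|].
      rewrite nC_fact_S; simpl.
      field; split; [apply nC_fact_neq0 | apply nC_S_neq0].
  - destruct (IHp q) as [a Ha].
    assert (Hs : exists a', is_wirtinger
       (fun u => shift (hcoef t u (Cconj u) p) q) z a'
       (shift (shift (hcoef t z (Cconj z) p)) q)).
    { destruct q as [|q]; simpl; [exists 0; apply is_wirtinger_const | apply IHp]. }
    destruct Hs as [a' Ha'].
    assert (H := is_wirtinger_scal (/ nC (S p)) _ _ _ _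
      (is_wirtinger_plus _ _ _ _ _ _ _
        (is_wirtinger_mult _ _ _ _ _ _ _ (is_wirtinger_id z) Ha)
        (is_wirtinger_scal (- t) _ _ _ _ Ha'))).
    eexists.
    replace (fun u => hcoef t u (Cconj u) (S p) q)
      with (fun u => / nC (S p) * (u * hcoef t u (Cconj u) p q
              + - t * shift (hcoef t u (Cconj u) p) q)).
    + replace (shift (hcoef t z (Cconj z) (S p)) q)
        with (/ nC (S p) * (0 * hcoef t z (Cconj z) p q
               + z * shift (hcoef t z (Cconj z) p) q
               + - t * shift (shift (hcoef t z (Cconj z) p)) q)); [exact H|].
      (* The recurrence in [p] commutes with the shift in [q]. *)
      destruct q as [|q]; cbn [shift hcoef]; unfold Cdiv; ring.
    + apply functional_extensionality; intros u; cbn [hcoef]; unfold Cdiv; ring.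
Qed.

(** * Hermite polynomials as generating function coefficients *)

Lemma iter_partial_z_gauss q :
  Nat.iter q partial_z gauss = fun u => (- 1) ^ q * (Cconj u ^ q * gauss u).
Proof.
  induction q as [|q IHq]; apply functional_extensionality; intros u.
  - simpl; ring.
  - simpl Nat.iter; rewrite IHq.
    (* Powers of zbar have zero derivative along [z], so each step only brings down [- Cconj u] from
       the Gaussian. *)
    rewrite (partial_z_unique _ _ _ _ (is_wirtinger_scal _ _ _ _ _
      (is_wirtinger_mult _ _ _ _ _ _ _
        (is_wirtinger_conj_pow q u) (is_wirtinger_gauss u)))).
    simpl; ring.
Qed.

(** Differentiating [hcoef * gauss] along zbar gives the shifted coefficient minus [u] times the
    coefficient, which is [- nC (S p)] times the next one, by the recurrence at [t = 1]. *)
Lemma iter_partial_zbar_gauss p q :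
  Nat.iter p partial_zbar (Nat.iter q partial_z gauss)
  = fun u => (- 1) ^ (p + q) * (nC (fact p) * nC (fact q))
             * (hcoef 1 u (Cconj u) p q * gauss u).
Proof.
  induction p as [|p IHp]; apply functional_extensionality; intros u.
  - simpl Nat.iter; rewrite iter_partial_z_gauss; simpl.
    change (nC 1) with (RtoC 1); field; apply nC_fact_neq0.
  - simpl Nat.iter; rewrite IHp.
    destruct (is_wirtinger_hcoef 1 p q u) as [a Ha].
    rewrite (partial_zbar_unique _ _ _ _ (is_wirtinger_scal _ _ _ _ _
      (is_wirtinger_mult _ _ _ _ _ _ _ Ha (is_wirtinger_gauss u)))).
    rewrite nC_fact_S.
    transitivity ((- 1) ^ (S p + q) * (nC (fact p) * nC (fact q))
      * ((nC (S p) * hcoef 1 u (Cconj u) (S p) q) * gauss u)); [|ring].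
    rewrite hcoef_S; simpl; ring.
Qed.

Lemma hermiteC_hcoef p q z :
  hermiteC p q z = nC (fact p) * nC (fact q) * hcoef 1 z (Cconj z) p q.
Proof.
  unfold hermiteC.
  change (fun u => Cexp (- (u * Cconj u))) with gauss.
  rewrite iter_partial_zbar_gauss.
  (* One sign comes from the definition and one from the differentiations; they cancel, as do the
     two exponentials. *)
  transitivity (((- 1) ^ (p + q) * (- 1) ^ (p + q))
    * (Cexp (z * Cconj z) * gauss z)
    * (nC (fact p) * nC (fact q) * hcoef 1 z (Cconj z) p q)); [ring|].
  rewrite Cexp_gauss, <- Cpow_mult_l.
  replace (- 1 * - 1) with (RtoC 1) by (rewrite <- RtoC_mult; f_equal; ring).
  rewrite Cpow_1_l; ring.
Qed.

(** * The addition formula *)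

Lemma Rpower_half_nat n : Rpower (1 / 2) (INR n / 2) = ((/ sqrt 2) ^ n)%R.
Proof.
  assert (Hs : (0 < / sqrt 2)%R) by (apply Rinv_0_lt_compat, sqrt_lt_R0; lra).
  rewrite <- Rpower_pow by exact Hs.
  replace (1 / 2)%R with (Rpower (/ sqrt 2) 2).
  - rewrite Rpower_mult; f_equal; field.
  - change 2%R with (INR 2) at 2; rewrite Rpower_pow by exact Hs.
    rewrite pow_inv; simpl; rewrite Rmult_1_r, sqrt_sqrt by lra; field.
Qed.

Theorem proposition3p11 : forall (p q : nat) (z w : C),
  hermiteC p q (z + w)%C =
  (RtoC (INR (fact p)) * RtoC (INR (fact q))
   * RtoC (Rpower (1 / 2) (INR (p + q) / 2))
   * sum_n (fun j : nat => sum_n (fun k : nat =>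
       hermiteC j k (RtoC (sqrt 2) * z)
         / (RtoC (INR (fact k)) * RtoC (INR (fact j)))
       * (hermiteC (p - j) (q - k) (RtoC (sqrt 2) * w)
         / (RtoC (INR (fact (q - k))) * RtoC (INR (fact (p - j)))))) q) p)%C.
Proof.
  intros p q z w.
  rewrite Rpower_half_nat, RtoC_pow.
  set (s := RtoC (sqrt 2)); set (r := RtoC (/ sqrt 2)).
  assert (Hs0 : sqrt 2 <> 0%R) by (apply Rgt_not_eq, sqrt_lt_R0; lra).
  assert (Hrs : r * s = 1)
    by (unfold r, s; rewrite <- RtoC_mult; f_equal; field; exact Hs0).
  (* The parameter [t = 1] splits into two halves, each in the form [r * r * 1] that [hcoef_scale]
     expects. *)
  assert (Hrr : r * r * 1 + r * r * 1 = 1).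
  { unfold r; rewrite <- !RtoC_mult, <- RtoC_plus; f_equal.
    transitivity (2 / (sqrt 2 * sqrt 2))%R; [field; exact Hs0|].
    rewrite sqrt_sqrt by lra; field. }
  assert (Hconj : forall v, Cconj (s * v) = s * Cconj v)
    by (intros v; apply injective_projections; simpl; ring).
  rewrite hermiteC_hcoef; fold (nC (fact p)) (nC (fact q)).
  rewrite <- (Cmult_assoc (nC (fact p) * nC (fact q))); f_equal.
  rewrite <- Hrr.
  (* Inserting [r * s = 1] produces the arguments scaled by [sqrt 2] and leaves [r] to be
     extracted. *)
  replace (Cconj (z + w)) with (r * (s * Cconj z) + r * (s * Cconj w)).
  2: { rewrite !Cmult_assoc, Hrs; apply injective_projections; simpl; ring. }
  replace (z + w) with (r * (s * z) + r * (s * w))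
    by (rewrite !Cmult_assoc, Hrs; ring).
  rewrite hcoef_add; unfold conv, diag_sum.
  rewrite <- (sum_n_mult_l (K := C_Ring)).
  apply sum_n_ext_C; intros j Hj.
  rewrite <- (sum_n_mult_l (K := C_Ring)).
  apply sum_n_ext_C; intros k Hk.
  rewrite !hcoef_scale, !hermiteC_hcoef, !Hconj.
  (* By [j <= p] and [k <= q], the powers of [r] from the two factors combine to [r ^ (p + q)] in
     every term. *)
  replace (p + q)%nat with ((j + k) + (p - j + (q - k)))%nat by lia.
  rewrite !Cpow_add_r.
  change (@mult C_Ring) with Cmult.
  fold (nC (fact j)) (nC (fact k)) (nC (fact (p - j))) (nC (fact (q - k))).
  field; repeat split; apply nC_fact_neq0.
Qed.
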